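(* Let $\mathcal{D}[t]\subset\mathcal{H}\subset\mathcal{D}^\times[t^\times]$ be a rigged Hilbert space with $\mathcal{D}[t]$ complete and reflexive, and let $\{\xi_n\}$ be a sequence of elements of $\mathcal{D}$. The following statements are equivalent. (i) $\{\xi_n\}$ is a Riesz-like basis and the one-to-one operator $T\in\mathcal{C}(\mathcal{D},\mathcal{H})$ for which $\{T\xi_n\}$ is an orthonormal basis of $\mathcal{H}$ has a continuous inverse, i.e. $T^{-1}\in\mathcal{C}(\mathcal{H},\mathcal{D})$ ($T^{-1}$ is defined on all of $\mathcal{H}$ and continuous from $\mathcal{H}$ into $\mathcal{D}[t]$). (ii) $\mathcal{D}$ can be endowed with an inner product $\langle\cdot,\cdot\rangle_{+1}$ such that the topology induced by the corresponding norm $\|\cdot\|_{+1}$ is equivalent to $t$, $\mathcal{D}[\|\cdot\|_{+1}]$ is a Hilbert space, and $\{\xi_n\}$ is an orthonormal basis for $\mathcal{D}[\|\cdot\|_{+1}]$. (iii) $\{\xi_n\}$ is complete (has dense linear span) in $\mathcal{D}[t]$, and there exists a continuous seminorm $p$ on $\mathcal{D}[t]$ such that for every $n\in\mathbb{N}$ and complex numbers $c_1,\dots,c_n$, $$\sum_{i=1}^n|c_i|^2\leq p\Big(\sum_{i=1}^nc_i\xi_i\Big)^2,$$ and for every continuous seminorm $q$ on $\mathcal{D}[t]$ there exists $C_q>0$ such that $$q\Big(\sum_{i=1}^nc_i\xi_i\Big)^2\leq C_q\sum_{i=1}^n|c_i|^2$$ for every $n\in\mathbb{N}$ and complex numbers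 $c_1,\dots,c_n$.
   Context: A rigged Hilbert space $\mathcal{D}[t]\subset\mathcal{H}\subset\mathcal{D}^\times[t^\times]$: $\mathcal{D}$ is a dense subspace of the Hilbert space $\mathcal{H}$ with a locally convex topology $t$ finer than the norm topology, $\mathcal{D}^\times$ is the space of continuous conjugate-linear functionals on $\mathcal{D}[t]$ with the strong dual topology $t^\times=\beta(\mathcal{D}^\times,\mathcal{D})$, and $\mathcal{H}\subset\mathcal{D}^\times$ with the duality extending the inner product. A Schauder basis of $\mathcal{D}[t]$ is a sequence $\{\xi_n\}$ such that every $f\in\mathcal{D}$ has a unique expansion $f=\sum c_n\xi_n$ converging in $\mathcal{D}[t]$ with $t$-continuous coefficient functionals. $\mathcal{C}(\mathcal{D},\mathcal{H})$ denotes the linear maps from $\mathcal{D}$ into $\mathcal{H}$ continuous from $\mathcal{D}[t]$ into $\mathcal{H}[\|\cdot\|]$ (regarded as elements of the continuous linear maps $\mathcal{D}[t]\to\mathcal{D}^\times[t^\times]$). A Schauder basis $\{\xi_n\}$ of $\mathcal{D}[t]$ is a Riesz-like basis if there exists a one-to-one $T\in\mathcal{C}(\mathcal{D},\mathcal{H})$ such that $\{T\xi_n\}$ is an orthonormal basis of $\mathcal{H}$. *)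

(* Defs.v *)
From HB Require Import structures.
From mathcomp Require Import all_boot all_order all_algebra.
From mathcomp Require Import complex.
From mathcomp Require Import boolp classical_sets functions filter reals.
Set Implicit Arguments.
Unset Strict Implicit.
Unset Printing Implicit Defensive.
Import Order.TTheory GRing.Theory Num.Theory.
Local Open Scope classical_set_scope.
Local Open Scope ring_scope.

Definition cabs {R : realType} (z : R[i]) : R := Normc.normc z.

(* A locally convex topology on a subset DU (a subspace) of a vector   *)
(* space U is given by a family SU of seminorms; basic neighbourhoods  *)
(* of f are the sets {g in DU | p_i (g - f) < d, i < k} for finitely   *)
(* many p_i in SU and d > 0.                                           *)

Definition lc_cont {R : realType} (U V : zmodType) (DU : set U)
    (SU : set (U -> R)) (SV : set (V -> R)) (F : U -> V) : Prop :=
  forall f, DU f -> forall q, SV q -> forall e : R, 0 < e ->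
    exists (k : nat) (ps : 'I_k -> U -> R) (d : R),
      [/\ (forall i, SU (ps i)), 0 < d &
        forall g, DU g -> (forall i, ps i (g - f) < d) -> q (F g - F f) < e].

(* The inverse of [F] (restricted to DU) is continuous from F(DU) with the
   topology of SV back to (DU, topology of SU); i.e. F is open onto its image. *)
Definition lc_cont_inv {R : realType} (U V : zmodType) (DU : set U)
    (SU : set (U -> R)) (SV : set (V -> R)) (F : U -> V) : Prop :=
  forall f, DU f -> forall q, SU q -> forall e : R, 0 < e ->
    exists (k : nat) (ps : 'I_k -> V -> R) (d : R),
      [/\ (forall i, SV (ps i)), 0 < d &
        forall g, DU g -> (forall i, ps i (F g - F f) < d) -> q (g - f) < e].

Definition abs_family (R : realType) : set (R -> R) := [set fun x => `|x|].
Definition cabs_family (R : realType) : set (R[i] -> R) := [set @cabs R].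

Definition subspace {R : realType} (U : lmodType R[i]) (D : set U) : Prop :=
  D 0 /\ forall (a : R[i]) f g, D f -> D g -> D (a *: f + g).

Definition linear_on {R : realType} (U V : lmodType R[i]) (D : set U)
    (T : U -> V) : Prop :=
  forall (a : R[i]) f g, D f -> D g -> T (a *: f + g) = a *: T f + T g.

Definition linear_functional_on {R : realType} (U : lmodType R[i])
    (D : set U) (phi : U -> R[i]) : Prop :=
  forall (a : R[i]) f g, D f -> D g -> phi (a *: f + g) = a * phi f + phi g.

Definition seminorm_on {R : realType} (U : lmodType R[i]) (D : set U)
    (p : U -> R) : Prop :=
  [/\ forall f, D f -> 0 <= p f,
      forall (a : R[i]) f, D f -> p (a *: f) = cabs a * p f &
      forall f g, D f -> D g -> p (f + g) <= p f + p g].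

Definition cont_seminorm {R : realType} (U : lmodType R[i]) (D : set U)
    (S : set (U -> R)) (q : U -> R) : Prop :=
  seminorm_on D q /\ lc_cont D S (@abs_family R) q.

Definition inner_product_on {R : realType} (U : lmodType R[i]) (D : set U)
    (ip : U -> U -> R[i]) : Prop :=
  [/\ forall (a : R[i]) f g h, D f -> D g -> D h ->
        ip (a *: f + g) h = a * ip f h + ip g h,
      forall f g, D f -> D g -> ip g f = conjc (ip f g),
      forall f, D f -> 0 <= ip f f &
      forall f, D f -> ip f f = 0 -> f = 0].

Definition ipnorm {R : realType} (U : lmodType R[i]) (ip : U -> U -> R[i])
    (f : U) : R := Num.sqrt (complex.Re (ip f f)).

Definition ip_complete {R : realType} (U : lmodType R[i]) (D : set U)
    (ip : U -> U -> R[i]) : Prop :=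
  forall u : nat -> U, (forall n, D (u n)) ->
    (forall e : R, 0 < e -> exists N, forall m n, (N <= m)%N -> (N <= n)%N ->
        ipnorm ip (u m - u n) < e) ->
    exists2 h, D h & forall e : R, 0 < e -> exists N, forall n, (N <= n)%N ->
        ipnorm ip (u n - h) < e.

Definition hilbert_on {R : realType} (U : lmodType R[i]) (D : set U)
    (ip : U -> U -> R[i]) : Prop :=
  [/\ subspace D, inner_product_on D ip & ip_complete D ip].

Definition onb_on {R : realType} (U : lmodType R[i]) (D : set U)
    (ip : U -> U -> R[i]) (e : nat -> U) : Prop :=
  [/\ forall n, D (e n),
      forall m n, ip (e m) (e n) = if m == n then 1 else 0 &
      forall f, D f -> forall eps : R, 0 < eps ->
        exists (n : nat) (c : nat -> R[i]),
          ipnorm ip (f - \sum_(i < n) c i *: e i) < eps].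

Definition lc_complete {R : realType} (U : lmodType R[i]) (D : set U)
    (S : set (U -> R)) : Prop :=
  forall F : set_system U, ProperFilter F -> F D ->
    (forall p, S p -> forall e : R, 0 < e ->
       exists2 A, F A & forall x y, A x -> A y -> p (x - y) < e) ->
    exists2 f, D f & forall p, S p -> forall e : R, 0 < e ->
       F [set g | p (g - f) < e].

Definition lc_bounded {R : realType} (U : lmodType R[i]) (D : set U)
    (S : set (U -> R)) (B : set U) : Prop :=
  B `<=` D /\ forall p, S p -> exists M : R, forall f, B f -> p f <= M.

Definition lc_dual {R : realType} (U : lmodType R[i]) (D : set U)
    (S : set (U -> R)) : set (U -> R[i]) :=
  [set phi | linear_functional_on D phi /\ lc_cont D S (@cabs_family R) phi].

Definition strong_seminorms {R : realType} (U : lmodType R[i]) (D : set U)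
    (S : set (U -> R)) : set ((U -> R[i]) -> R) :=
  [set P | exists B, lc_bounded D S B /\
     P = fun phi => sup [set cabs (phi f) | f in B]].

Definition strong_bounded {R : realType} (U : lmodType R[i]) (D : set U)
    (S : set (U -> R)) (B' : set (U -> R[i])) : Prop :=
  lc_bounded (lc_dual D S) (strong_seminorms D S) B'.

Definition lc_bidual {R : realType} (U : lmodType R[i]) (D : set U)
    (S : set (U -> R)) : set ((U -> R[i]) -> R[i]) :=
  [set Phi | (forall (a : R[i]) phi psi, lc_dual D S phi -> lc_dual D S psi ->
                Phi (fun x => a * phi x + psi x) = a * Phi phi + Phi psi)
          /\ lc_cont (lc_dual D S) (strong_seminorms D S) (@cabs_family R) Phi].

Definition bidual_seminorms {R : realType} (U : lmodType R[i]) (D : set U)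
    (S : set (U -> R)) : set (((U -> R[i]) -> R[i]) -> R) :=
  [set P | exists B', strong_bounded D S B' /\
     P = fun Phi => sup [set cabs (Phi phi) | phi in B']].

Definition canonical_embedding {R : realType} (U : lmodType R[i])
    (f : U) : (U -> R[i]) -> R[i] := fun phi => phi f.

Definition lc_reflexive {R : realType} (U : lmodType R[i]) (D : set U)
    (S : set (U -> R)) : Prop :=
  [/\ forall Phi, lc_bidual D S Phi ->
        exists2 f, D f & forall phi, lc_dual D S phi ->
          Phi phi = canonical_embedding f phi,
      lc_cont D S (bidual_seminorms D S) (@canonical_embedding R U) &
      lc_cont_inv D S (bidual_seminorms D S) (@canonical_embedding R U)].

Definition rigged_hilbert_space {R : realType} (H : lmodType R[i])
    (ip : H -> H -> R[i]) (D : set H) (S : set (H -> R)) : Prop :=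
  [/\ hilbert_on setT ip,
      subspace D,
      (forall h e, 0 < e -> exists2 f, D f & ipnorm ip (h - f) < e),
      (forall p, S p -> seminorm_on D p) &
      lc_cont D S [set ipnorm ip] id].

Definition lc_series_conv {R : realType} (U : lmodType R[i])
    (S : set (U -> R)) (xi : nat -> U) (c : nat -> R[i]) (f : U) : Prop :=
  forall p, S p -> forall e : R, 0 < e -> exists N, forall n, (N <= n)%N ->
    p (f - \sum_(i < n) c i *: xi i) < e.

Definition schauder_basis {R : realType} (U : lmodType R[i]) (D : set U)
    (S : set (U -> R)) (xi : nat -> U) : Prop :=
  (forall n, D (xi n)) /\
  exists coef : nat -> U -> R[i],
    (forall n, lc_cont D S (@cabs_family R) (coef n)) /\
    (forall f, D f ->
       lc_series_conv S xi (fun n => coef n f) f /\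
       forall c, lc_series_conv S xi c f -> c = fun n => coef n f).

Definition riesz_operator {R : realType} (H : lmodType R[i])
    (ip : H -> H -> R[i]) (D : set H) (S : set (H -> R)) (xi : nat -> H)
    (T : H -> H) : Prop :=
  [/\ linear_on D T,
      lc_cont D S [set ipnorm ip] T,
      {in D &, injective T} &
      onb_on setT ip (fun n => T (xi n))].

Definition riesz_like_basis {R : realType} (H : lmodType R[i])
    (ip : H -> H -> R[i]) (D : set H) (S : set (H -> R)) (xi : nat -> H) :
    Prop :=
  schauder_basis D S xi /\ exists T, riesz_operator ip D S xi T.

(* Main.v *)
Require Import Defs.
From HB Require Import structures.
From mathcomp Require Import all_boot all_order all_algebra.
From mathcomp Require Import complex.
From mathcomp Require Import boolp classical_sets functions filter reals.
From mathcomp Require Import ring lra.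
Set Implicit Arguments.
Unset Strict Implicit.
Unset Printing Implicit Defensive.
Import Order.TTheory GRing.Theory Num.Theory.
Local Open Scope classical_set_scope.
Local Open Scope ring_scope.
Local Open Scope complex_scope.

(* Cyclic proof (i) => (ii) => (iii) => (i).  An invertible T transports the
   inner product of H to D, and the resulting norm gives the two bounds of
   (iii).  Conversely, the lower bound makes the xi_n linearly independent, and
   Gram-Schmidt in H turns them into an orthonormal basis e_n of H, because
   their span is dense in D and D is dense in H.  The bounds say that
   sum c_i xi_i |-> sum c_i e_i is a homeomorphism between the spans, so by
   completeness of both sides its closure is the graph of an isomorphism T of
   D[t] onto H.  The Schauder expansion in D[t] is the image under T^-1 of the
   Fourier expansion in e_n. *)

(** * The modulus on the complex numbers *)

Lemma cabs_ge0 (R : realType) (z : R[i]) : 0 <= cabs z.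
Proof. by case: z => a b; rewrite /cabs /= sqrtr_ge0. Qed.

Lemma cabs0 (R : realType) : cabs (0 : R[i]) = 0.
Proof. exact: Normc.normc0. Qed.

Lemma cabsN (R : realType) (z : R[i]) : cabs (- z) = cabs z.
Proof. exact: normcN. Qed.

Lemma cabs_real (R : realType) (x : R) : cabs x%:C = `|x|.
Proof. by rewrite /cabs /= expr0n /= addr0 sqrtr_sqr. Qed.

Lemma mulcJ_cabs (R : realType) (z : R[i]) : z * conjc z = (cabs z ^+ 2)%:C.
Proof. by rewrite rmorphXn /= -sqr_normc. Qed.

Lemma Re_le_cabs (R : realType) (z : R[i]) : complex.Re z <= cabs z.
Proof.
case: z => a b; rewrite /cabs /=; apply: (le_trans (ler_norm a)).
by rewrite -sqrtr_sqr ler_wsqrtr // lerDl sqr_ge0.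
Qed.

(** * Subspaces and finite linear combinations *)

Section Subspace.
Variables (R : realType) (U : lmodType R[i]) (D : set U).
Hypothesis Dsub : subspace D.

Lemma subspace0 : D 0. Proof. by case: Dsub. Qed.

Lemma subspaceZ (a : R[i]) f : D f -> D (a *: f).
Proof.
by move=> Df; rewrite -[_ *: _]addr0; apply: (proj2 Dsub) => //; exact: subspace0.
Qed.

Lemma subspaceD f g : D f -> D g -> D (f + g).
Proof. by move=> Df Dg; rewrite -[f]scale1r; apply: (proj2 Dsub). Qed.

Lemma subspaceB f g : D f -> D g -> D (f - g).
Proof.
by move=> Df Dg; rewrite addrC -scaleN1r; apply: (proj2 Dsub).
Qed.

End Subspace.

Lemma subspaceT (R : realType) (U : lmodType R[i]) : subspace [set: U].
Proof. by []. Qed.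

(** The coefficients form a total sequence, so one [c] can be cut at every length and can represent
    a whole series. *)
Definition lincomb {R : realType} {U : lmodType R[i]} (x : nat -> U) (n : nat)
  (c : nat -> R[i]) : U := \sum_(i < n) c i *: x i.

Section LinearCombination.
Variables (R : realType) (U : lmodType R[i]).
Implicit Types (x : nat -> U) (c : nat -> R[i]).

(** Padding with zeros brings combinations of different lengths to a common one, where they can be
    added or subtracted termwise. *)
Lemma lincomb_widen x n m c : (n <= m)%N ->
  lincomb x n c = lincomb x m (fun i => if (i < n)%N then c i else 0).
Proof.
move=> nm; rewrite /lincomb (big_ord_widen m (fun i => c i *: x i)) // big_mkcond.
by apply: eq_bigr => i _; case: ifP => //; rewrite scale0r.
Qed.

Lemma lincombD x n a c c' :
  lincomb x n (fun i => a * c i + c' i) = a *: lincomb x n c + lincomb x n c'.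
Proof.
rewrite /lincomb scaler_sumr -big_split; apply: eq_bigr => i _ /=.
by rewrite scalerDl scalerA.
Qed.

Lemma lincombB x n c c' :
  lincomb x n (fun i => c i - c' i) = lincomb x n c - lincomb x n c'.
Proof.
rewrite /lincomb -sumrB; apply: eq_bigr => i _ /=.
by rewrite scalerBl.
Qed.

Lemma lincombS x n c : lincomb x n.+1 c = lincomb x n c + c n *: x n.
Proof. by rewrite /lincomb big_ord_recr. Qed.

Lemma lincomb_delta x n : lincomb x n.+1 (fun i => (i == n)%:R) = x n.
Proof.
rewrite lincombS eqxx scale1r /lincomb big1 ?add0r // => i _.
by rewrite ltn_eqF ?scale0r.
Qed.

Lemma subspace_lincomb (D : set U) x n c :
  subspace D -> (forall i, D (x i)) -> D (lincomb x n c).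
Proof.
move=> Dsub Dx; elim: n => [|n IH].
  by rewrite /lincomb big_ord0; exact: subspace0.
by rewrite lincombS; apply: subspaceD => //; apply: subspaceZ.
Qed.

End LinearCombination.

(** * Inner products and their norms *)

Section InnerProduct.
Variables (R : realType) (U : lmodType R[i]) (D : set U) (ip : U -> U -> R[i]).
Hypotheses (Dsub : subspace D) (ipP : inner_product_on D ip).
Local Notation N := (ipnorm ip).

Let D0 := subspace0 Dsub.

Lemma ip_linl a f g h : D f -> D g -> D h -> ip (a *: f + g) h = a * ip f h + ip g h.
Proof. by case: ipP => + _ _ _; exact. Qed.

Lemma ip_conj f g : D f -> D g -> ip g f = conjc (ip f g).
Proof. by case: ipP => _ + _ _; exact. Qed.

Lemma ip0l h : D h -> ip 0 h = 0.
Proof.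
move=> Dh; have := @ip_linl (-1) 0 0 h D0 D0 Dh.
by rewrite scaler0 addr0 mulN1r addNr.
Qed.

Lemma ipDl f g h : D f -> D g -> D h -> ip (f + g) h = ip f h + ip g h.
Proof. by move=> *; rewrite -[f in LHS]scale1r ip_linl // mul1r. Qed.

Lemma ipZl a f h : D f -> D h -> ip (a *: f) h = a * ip f h.
Proof. by move=> *; rewrite -[_ *: _]addr0 ip_linl // ip0l // addr0. Qed.

Lemma ipBl f g h : D f -> D g -> D h -> ip (f - g) h = ip f h - ip g h.
Proof.
by move=> *; rewrite addrC -scaleN1r ip_linl // mulN1r addrC.
Qed.

Lemma ipDr f g h : D f -> D g -> D h -> ip h (f + g) = ip h f + ip h g.
Proof.
move=> *; rewrite (@ip_conj (f + g)) ?ipDl // ?rmorphD; last exact: subspaceD.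
by rewrite /= -!ip_conj.
Qed.

Lemma ipZr a f h : D f -> D h -> ip h (a *: f) = conjc a * ip h f.
Proof.
move=> *; rewrite (@ip_conj (a *: f)) ?ipZl // ?rmorphM; last exact: subspaceZ.
by rewrite /= -ip_conj.
Qed.

Lemma ipBr f g h : D f -> D g -> D h -> ip h (f - g) = ip h f - ip h g.
Proof.
move=> *; rewrite (@ip_conj (f - g)) ?ipBl // ?rmorphB; last exact: subspaceB.
by rewrite /= -!ip_conj.
Qed.

Lemma ip_lincombl x n c h : (forall i, D (x i)) -> D h ->
  ip (lincomb x n c) h = \sum_(i < n) c i * ip (x i) h.
Proof.
move=> Dx Dh; elim: n => [|n IH]; first by rewrite /lincomb !big_ord0 ip0l.
rewrite lincombS big_ord_recr /= ipDl ?IH ?ipZl //.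
  exact: subspace_lincomb.
exact: subspaceZ.
Qed.

Lemma ipnorm_ge0 f : 0 <= N f. Proof. exact: sqrtr_ge0. Qed.

(** In the order of [R[i]], [0 <= z] forces the imaginary part of [z] to vanish, so the real part
    taken in [ipnorm] loses nothing. *)
Lemma ip_self f : D f -> ip f f = (N f ^+ 2)%:C.
Proof.
move=> Df; have ff : 0 <= ip f f by case: ipP => _ _ + _; exact.
have Im0 := ger0_Im ff.
move: ff; rewrite /ipnorm lecE => /andP[_ /= Re0].
by rewrite sqr_sqrtr // [LHS]complexE Im0 mulr0 addr0.
Qed.

Lemma ipnorm_eq0 f : D f -> N f = 0 -> f = 0.
Proof.
move=> Df N0; case: ipP => _ _ _; apply=> //.
by rewrite ip_self // N0 expr0n.
Qed.

Lemma ipnormZ a f : D f -> N (a *: f) = cabs a * N f.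
Proof.
move=> Df; have Daf := subspaceZ Dsub a Df.
apply/eqP; rewrite -(@eqrXn2 _ 2) ?ipnorm_ge0 ?mulr_ge0 ?cabs_ge0 ?ipnorm_ge0 //.
apply/eqP/complexI; rewrite exprMn -ip_self // rmorphM /= -ip_self // -mulcJ_cabs.
by rewrite ipZl // ipZr // mulrA.
Qed.

Lemma ip_CauchySchwarz f g : D f -> D g -> cabs (ip f g) <= N f * N g.
Proof.
move=> Df Dg; have [Ng0|Ng0] := eqVneq (N g) 0.
  rewrite Ng0 mulr0 (ipnorm_eq0 Dg Ng0) ip_conj ?ip0l //.
  by rewrite rmorph0 cabs0.
rewrite -(@ler_pXn2r _ 2) ?nnegrE ?cabs_ge0 ?mulr_ge0 ?ipnorm_ge0 //.
(* The residual of [f] after projection onto [g], scaled by [ip g g] to avoid a division; its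
   squared norm is [N g ^+ 2] times the gap in the squared inequality. *)
pose u := ip g g *: f - ip f g *: g.
have Dbf : D (ip g g *: f) by exact: subspaceZ.
have Dag : D (ip f g *: g) by exact: subspaceZ.
have Du : D u by exact: subspaceB.
have : 0 <= N g ^+ 2 * (N f ^+ 2 * N g ^+ 2 - cabs (ip f g) ^+ 2).
  suff -> : N g ^+ 2 * (N f ^+ 2 * N g ^+ 2 - cabs (ip f g) ^+ 2) = N u ^+ 2.
    exact: sqr_ge0.
  apply: complexI; rewrite -ip_self // /u ipBl // !ipBr // !ipZl // !ipZr //.
  rewrite (@ip_conj f g) // !(ip_self Df, ip_self Dg) conjc_real.
  rewrite rmorphM rmorphB /= -mulcJ_cabs !rmorphM /=; ring.
rewrite pmulr_rge0; last by rewrite exprn_gt0 // lt_def Ng0 ipnorm_ge0.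
by rewrite subr_ge0 exprMn.
Qed.

Lemma ipnormD f g : D f -> D g -> N (f + g) <= N f + N g.
Proof.
move=> Df Dg; have Dfg := subspaceD Dsub Df Dg.
rewrite -(@ler_pXn2r _ 2) ?nnegrE ?addr_ge0 ?ipnorm_ge0 //.
have -> : N (f + g) ^+ 2 = N f ^+ 2 + N g ^+ 2 + complex.Re (ip f g) *+ 2.
  apply: complexI; rewrite -ip_self // ipDl // !ipDr // (@ip_conj f g) //.
  rewrite !rmorphD /= -!ip_self //.
  transitivity (ip f f + ip g g + (ip f g + conjc (ip f g))); first by ring.
  by rewrite addcJ; ring.
rewrite sqrrD addrAC lerD2r lerD2l lerMn2r /=.
exact: (le_trans (Re_le_cabs _) (ip_CauchySchwarz Df Dg)).
Qed.

Lemma ipnorm_seminorm : seminorm_on D N.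
Proof.
split=> [f _|a f|f g]; [exact: ipnorm_ge0|exact: ipnormZ|exact: ipnormD].
Qed.

End InnerProduct.

(** * Orthonormal sequences and Fourier expansions *)

Section Orthonormal.
Variables (R : realType) (U : lmodType R[i]) (D : set U) (ip : U -> U -> R[i]).
Hypotheses (Dsub : subspace D) (ipP : inner_product_on D ip).
Variable e : nat -> U.
Hypotheses (De : forall n, D (e n))
  (eON : forall m n, ip (e m) (e n) = if m == n then 1 else 0).
Local Notation N := (ipnorm ip).

Lemma ip_lincomb_orthonormal n c j : (j < n)%N -> ip (lincomb e n c) (e j) = c j.
Proof.
move=> jn; rewrite (ip_lincombl Dsub ipP) //.
rewrite (bigD1 (Ordinal jn)) //= eON eqxx mulr1 big1 ?addr0 // => i ij.
by rewrite eON ifN ?mulr0.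
Qed.

Lemma ipnorm_orthonormal n : N (e n) = 1.
Proof. by rewrite /ipnorm eON eqxx sqrtr1. Qed.

Lemma ipnorm_lincomb_orthonormal n c :
  N (lincomb e n c) ^+ 2 = \sum_(i < n) cabs (c i) ^+ 2.
Proof.
have DL := subspace_lincomb n c Dsub De.
apply: complexI; rewrite -(ip_self ipP) // (ip_lincombl Dsub ipP) //.
rewrite rmorph_sum; apply: eq_bigr => i _ /=.
by rewrite (ip_conj ipP DL) // ip_lincomb_orthonormal // mulcJ_cabs.
Qed.

(* Pythagoras: h - P is orthogonal to P - x for every x in the span. *)
Lemma fourier_best_approx h n c : D h ->
  N (h - lincomb e n (fun i => ip h (e i))) <= N (h - lincomb e n c).
Proof.
move=> Dh; set P := lincomb e n _; set x := lincomb e n c.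
have DP : D P by rewrite /P; apply: subspace_lincomb.
have Dx : D x by rewrite /x; apply: subspace_lincomb.
have Du := subspaceB Dsub Dh DP.
have Dv := subspaceB Dsub DP Dx.
have Dw := subspaceB Dsub Dh Dx.
have vu : ip (P - x) (h - P) = 0.
  rewrite -lincombB (ip_lincombl Dsub ipP) // big1 // => i _.
  rewrite (ip_conj ipP Du) // (ipBl ipP) //.
  by rewrite ip_lincomb_orthonormal // subrr rmorph0 mulr0.
rewrite -(@ler_pXn2r _ 2) ?nnegrE ?ipnorm_ge0 //.
suff -> : N (h - x) ^+ 2 = N (h - P) ^+ 2 + N (P - x) ^+ 2.
  by rewrite lerDl sqr_ge0.
have -> : h - x = (P - x) + (h - P) by rewrite [RHS]addrC subrKA.
move: Du Dv vu; move: (h - P) (P - x) => u v Du Dv vu.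
have Dvu := subspaceD Dsub Dv Du.
apply: complexI; rewrite rmorphD /= -!(ip_self ipP) //.
rewrite (ipDl ipP) ?(ipDr Dsub ipP) // (ip_conj ipP Dv Du) vu.
by rewrite rmorph0 add0r addr0 addrC.
Qed.

(** One good approximation of length [n0] suffices: padded with zeros it competes at every length
    [n >= n0], and the Fourier sum is at least as close. *)
Lemma fourier_cvg h :
  (forall eps : R, 0 < eps -> exists n c, N (h - lincomb e n c) < eps) -> D h ->
  forall eps : R, 0 < eps -> exists n0, forall n, (n0 <= n)%N ->
    N (h - lincomb e n (fun i => ip h (e i))) < eps.
Proof.
move=> dense Dh eps /dense[n0 [c hc]]; exists n0 => n n0n.
apply: le_lt_trans hc; rewrite (lincomb_widen _ _ n0n).
exact: fourier_best_approx.
Qed.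

(** By Cauchy-Schwarz, [ip _ (e j)] is continuous, and on partial sums longer than [j] it takes the
    constant value [c j]. *)
Lemma fourier_coef_unique h c : D h ->
  (forall eps : R, 0 < eps -> exists n0, forall n, (n0 <= n)%N ->
    N (h - lincomb e n c) < eps) ->
  forall j, ip h (e j) = c j.
Proof.
move=> Dh hc j; apply/subr0_eq/(@Normc.eq0_normc R)/le_anti.
rewrite -/(cabs _) cabs_ge0 andbT; apply/ler_addgt0Pl => eps /hc[n0 n0P].
(* This length is large enough both for the estimate and for the sum to contain the term of index
   [j]. *)
have DL := subspace_lincomb (maxn n0 j.+1) c Dsub De.
have jn : (j < maxn n0 j.+1)%N by rewrite leq_max ltnSn orbT.
rewrite addr0 -(ip_lincomb_orthonormal c jn) -(ipBl ipP) //.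
apply: (le_trans (ip_CauchySchwarz Dsub ipP _ _)) => //; first exact: subspaceB.
by rewrite ipnorm_orthonormal mulr1 ltW // n0P // leq_maxl.
Qed.

End Orthonormal.

(** * Spans of initial segments and Gram-Schmidt orthonormalisation *)

Definition in_span {R : realType} {U : lmodType R[i]} (x : nat -> U) (n : nat)
  (y : U) : Prop := exists c, y = lincomb x n c.

Section Span.
Variables (R : realType) (U : lmodType R[i]).
Implicit Types (x y : nat -> U) (z : U).

Lemma in_span_gen x n i : (i < n)%N -> in_span x n (x i).
Proof.
move=> ltin; rewrite -[x i]lincomb_delta (lincomb_widen _ _ ltin).
by eexists.
Qed.

Lemma in_spanD x n a z z' :
  in_span x n z -> in_span x n z' -> in_span x n (a *: z + z').
Proof. by move=> [c ->] [c' ->]; rewrite -lincombD; eexists. Qed.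

Lemma in_spanZ x n a z : in_span x n z -> in_span x n (a *: z).
Proof.
move=> xz; rewrite -[_ *: _]addr0; apply: in_spanD => //.
by exists (fun=> 0); rewrite /lincomb big1 // => i _; rewrite scale0r.
Qed.

Lemma in_span_trans x y n m z : (forall i, (i < n)%N -> in_span y m (x i)) ->
  in_span x n z -> in_span y m z.
Proof.
move=> xy [c ->] {z}; elim: n xy => [|n IH] xy.
  rewrite /lincomb big_ord0 -(scale0r (y 0%N)).
  exists (fun=> 0); rewrite /lincomb scale0r big1 // => i _; exact: scale0r.
rewrite lincombS addrC; apply: in_spanD; first exact: xy.
by apply: IH => i /ltnW; exact: xy.
Qed.

Lemma in_span_widen x n m z : (n <= m)%N -> in_span x n z -> in_span x m z.
Proof.
by move=> nm; apply: in_span_trans => i ltin; apply: in_span_gen (leq_trans ltin nm).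
Qed.

End Span.

Section GramSchmidt.
Variables (R : realType) (U : lmodType R[i]) (D : set U) (ip : U -> U -> R[i]).
Hypotheses (Dsub : subspace D) (ipP : inner_product_on D ip).
Variable x : nat -> U.
Hypotheses (Dx : forall n, D (x n))
  (x_free : forall n c, lincomb x n c = 0 -> forall i, (i < n)%N -> c i = 0).
Local Notation N := (ipnorm ip).

(** Each stage returns the whole sequence built so far, zero from index [n] on. This makes a
    recursion that needs all earlier vectors structural. *)
Fixpoint gram_schmidt_upto (n : nat) : nat -> U :=
  if n is m.+1 then
    let g := gram_schmidt_upto m in
    let u := x m - lincomb g m (fun i => ip (x m) (g i)) in
    fun k => if k == m then (N u)^-1%:C *: u else g k
  else fun=> 0.

Definition gram_schmidt n := gram_schmidt_upto n.+1 n.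
Local Notation e := gram_schmidt.
Local Notation u n := (x n - lincomb e n (fun i => ip (x n) (e i))).

Lemma gram_schmidt_uptoE n k : (k < n)%N -> gram_schmidt_upto n k = e k.
Proof.
elim: n => // n IH; rewrite ltnS leq_eqVlt => /orP[/eqP->//|kn].
by rewrite /= ltn_eqF // IH.
Qed.

Lemma gram_schmidtE n : e n = (N (u n))^-1%:C *: u n.
Proof.
rewrite {1}/gram_schmidt /= eqxx.
have -> // : lincomb (gram_schmidt_upto n) n
    (fun i => ip (x n) (gram_schmidt_upto n i)) =
  lincomb e n (fun i => ip (x n) (e i)).
by apply: eq_bigr => i _; rewrite gram_schmidt_uptoE.
Qed.

Lemma gram_schmidt_in n : D (e n).
Proof.
elim/ltn_ind: n => n IH; rewrite gram_schmidtE; apply: subspaceZ => //.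
apply: subspaceB => //.
have : forall m, (m <= n)%N -> D (lincomb e m (fun i => ip (x n) (e i))).
  elim=> [|m IHm] mn; first by rewrite /lincomb big_ord0; exact: subspace0.
  rewrite lincombS; apply: (subspaceD Dsub (IHm (ltnW mn))).
  by apply: subspaceZ => //; exact: IH.
exact.
Qed.

(** Both claims are proved in one induction: since the earlier [e i] lie in the span of the earlier
    [x i], independence makes the residual nonzero, which is what allows its normalisation. *)
Lemma gram_schmidt_spec n :
  (forall i j, (i < n)%N -> (j < n)%N -> ip (e i) (e j) = if i == j then 1 else 0)
  /\ (forall i, (i < n)%N -> in_span x i.+1 (e i)).
Proof.
have De := gram_schmidt_in; elim: n => [|n [ON ex]]; first by split.
have DL := subspace_lincomb n (fun i => ip (x n) (e i)) Dsub De.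
have Du : D (u n) by exact: subspaceB.
have uspan : in_span x n (lincomb e n (fun i => ip (x n) (e i))).
  apply: (@in_span_trans _ _ e x n n); last by eexists.
  by move=> i ltin; apply: in_span_widen (ex i ltin).
have u_neq0 : u n != 0.
  apply/eqP => /subr0_eq xn; move: uspan; rewrite -xn => -[c xnc].
  (* If the residual vanished, [x n] would be a combination of its predecessors, giving a relation
     in which [x n] has coefficient 1. *)
  have /x_free/(_ n (ltnSn n))/eqP :
    lincomb x n.+1 (fun i => if (i < n)%N then - c i else 1) = 0.
    rewrite lincombS ltnn scale1r [X in _ + X]xnc /lincomb -big_split.
    rewrite big1 // => i _ /=.
    by rewrite ltn_ord scaleNr addNr.
  by rewrite ltnn oner_eq0.
have Nu0 : N (u n) != 0.
  by apply: contraNneq u_neq0 => N0; rewrite (ipnorm_eq0 ipP Du N0).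
have en_ei i : (i < n)%N -> ip (e n) (e i) = 0.
  move=> ltin; rewrite gram_schmidtE (ipZl Dsub ipP) // (ipBl ipP) //.
  rewrite (ip_lincombl Dsub ipP) // (bigD1 (Ordinal ltin)) //= ON // eqxx mulr1.
  rewrite big1 ?addr0 ?subrr ?mulr0 // => j ji.
  by rewrite ON // ifN ?mulr0.
have en_en : ip (e n) (e n) = 1.
  rewrite (ip_self ipP) // gram_schmidtE (ipnormZ Dsub ipP) // cabs_real.
  by rewrite ger0_norm ?invr_ge0 ?ipnorm_ge0 // mulVf // expr1n.
split=> [i j|i].
  rewrite !ltnS (leq_eqVlt i) (leq_eqVlt j) => /orP[/eqP->|ltin] /orP[/eqP->|ltjn].
  - by rewrite eqxx.
  - by rewrite en_ei // gtn_eqF.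
  - by rewrite (ip_conj ipP (De n)) // en_ei // rmorph0 ltn_eqF.
  - exact: ON.
rewrite ltnS leq_eqVlt => /orP[/eqP->|]; last exact: ex.
rewrite gram_schmidtE; apply: in_spanZ; rewrite addrC -scaleN1r.
apply: in_spanD; last exact: in_span_gen.
exact: in_span_widen uspan.
Qed.

Lemma gram_schmidt_orthonormal i j : ip (e i) (e j) = if i == j then 1 else 0.
Proof.
by apply: (gram_schmidt_spec (maxn i j).+1).1; rewrite ltnS (leq_maxl, leq_maxr).
Qed.

(** The recursion is solved for [x i], which becomes a multiple of [e i] plus its projection on the
    earlier vectors. *)
Lemma gram_schmidt_span n z : in_span x n z -> in_span e n z.
Proof.
apply: in_span_trans => i ltin; apply: in_span_widen ltin _.
have De := gram_schmidt_in.
have DL := subspace_lincomb i (fun j => ip (x i) (e j)) Dsub De.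
have Du : D (u i) by exact: subspaceB.
have -> : x i = (N (u i))%:C *: e i + lincomb e i (fun j => ip (x i) (e j)).
  rewrite gram_schmidtE scalerA -rmorphM /=.
  (* For a zero residual the convention [0^-1 = 0] does no harm: [x i] is then equal to its
     projection. *)
  have [N0|N0] := eqVneq (N (u i)) 0.
    by rewrite N0 mul0r scale0r add0r; apply/subr0_eq/(ipnorm_eq0 ipP Du).
  by rewrite divff // scale1r subrK.
apply: in_spanD; first exact: in_span_gen.
by apply: (@in_span_widen _ _ _ i) => //; eexists.
Qed.

End GramSchmidt.

(** * Seminorms and continuity in locally convex topologies *)

Section SeminormOn.
Variables (R : realType) (U : lmodType R[i]) (D : set U) (p : U -> R).
Hypotheses (Dsub : subspace D) (pP : seminorm_on D p).

Lemma seminorm_ge0 f : D f -> 0 <= p f.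
Proof. by case: pP => + _ _; exact. Qed.

Lemma seminormZ a f : D f -> p (a *: f) = cabs a * p f.
Proof. by case: pP => _ + _; exact. Qed.

Lemma seminormD f g : D f -> D g -> p (f + g) <= p f + p g.
Proof. by case: pP => _ _; exact. Qed.

Lemma seminorm0 : p 0 = 0.
Proof.
by rewrite -(scale0r (0 : U)) seminormZ ?cabs0 ?mul0r //; exact: subspace0.
Qed.

Lemma seminormBC f g : D f -> D g -> p (f - g) = p (g - f).
Proof.
move=> Df Dg; rewrite -(opprB g f) -(scaleN1r (g - f)) seminormZ; last exact: subspaceB.
by rewrite cabsN /cabs Normc.normc1 mul1r.
Qed.

Lemma seminorm_tri f g : D f -> D g -> p f <= p (f - g) + p g.
Proof.
by move=> Df Dg; rewrite -[in X in X <= _](subrK g f) seminormD //; exact: subspaceB.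
Qed.

Lemma seminorm_dist f g : D f -> D g -> `|p f - p g| <= p (f - g).
Proof.
move=> Df Dg; rewrite ler_norml lerBlDr seminorm_tri // andbT.
by rewrite lerNl opprB lerBlDr seminormBC // seminorm_tri.
Qed.

End SeminormOn.

Section ContinuousSeminorms.
Variables (R : realType) (U : lmodType R[i]) (D : set U).
Hypothesis Dsub : subspace D.
Implicit Types (S : set (U -> R)) (p q r : U -> R).

(** By the reverse triangle inequality, continuity of a seminorm at 0 already gives continuity
    everywhere. *)
Lemma cont_seminormP S r : seminorm_on D r ->
  (forall eps, 0 < eps -> exists (k : nat) (ps : 'I_k -> U -> R) (d : R),
    [/\ forall i, S (ps i), 0 < d &
      forall g, D g -> (forall i, ps i g < d) -> r g < eps]) <->
  cont_seminorm D S r.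
Proof.
move=> rP; split=> [r0|[_ rc] eps eps0].
  split=> // f Df _ -> eps /r0[k [ps [d [Sps d0 psd]]]].
  exists k, ps, d; split=> // g Dg gd.
  apply: (le_lt_trans (seminorm_dist Dsub rP Dg Df)).
  by apply: psd => //; exact: subspaceB.
have [k [ps [d [Sps d0 psd]]]] := rc 0 (subspace0 Dsub) _ erefl _ eps0.
exists k, ps, d; split=> // g Dg gd.
have := psd g Dg; rewrite !subr0 (seminorm0 Dsub rP) subr0.
rewrite ger0_norm ?(seminorm_ge0 rP) //.
exact.
Qed.

Lemma cont_seminorm_in S q : seminorm_on D q -> S q -> cont_seminorm D S q.
Proof.
move=> qP Sq; apply/cont_seminormP => // eps eps0.
by exists 1%N, (fun=> q), eps; split=> // g _; apply; exact: ord0.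
Qed.

Lemma cont_seminormD S p q : cont_seminorm D S p -> cont_seminorm D S q ->
  cont_seminorm D S (fun f => p f + q f).
Proof.
move=> cp cq; have [pP _] := cp; have [qP _] := cq; apply/cont_seminormP.
  split=> [f Df|a f Df|f g Df Dg].
  - by rewrite addr_ge0 ?(seminorm_ge0 pP) ?(seminorm_ge0 qP).
  - by rewrite (seminormZ pP) // (seminormZ qP) // mulrDr.
  - by rewrite addrACA lerD ?(seminormD pP) ?(seminormD qP).
move=> eps eps0; have eps2 : 0 < eps / 2 by rewrite divr_gt0.
have [k1 [ps1 [d1 [S1 d10 h1]]]] := (cont_seminormP S pP).2 cp _ eps2.
have [k2 [ps2 [d2 [S2 d20 h2]]]] := (cont_seminormP S qP).2 cq _ eps2.
(* The two finite families are concatenated, and the smaller radius serves for both. *)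
exists (k1 + k2)%N,
  (fun i => match fintype.split i with inl j => ps1 j | inr j => ps2 j end), (Num.min d1 d2).
split=> [i||g Dg gd]; first by case: fintype.split.
  by rewrite lt_min d10.
rewrite [eps]splitr ltrD ?h1 ?h2 // => i.
  have := gd (unsplit (inl i)); rewrite unsplitK lt_min => /andP[]//.
by have := gd (unsplit (inr i)); rewrite unsplitK lt_min => /andP[].
Qed.

(** A sum of finitely many seminorms dominates each of them, so a basic neighbourhood can be handled
    through a single continuous seminorm. *)
Lemma cont_seminorm_sum S k (ps : 'I_k -> U -> R) :
  (forall i, cont_seminorm D S (ps i)) ->
  cont_seminorm D S (fun f => \sum_i ps i f).
Proof.
elim: k ps => [|k IH] ps psc.
  rewrite (_ : (fun _ => _) = fun=> 0); last first.
    by apply: boolp.funext => f; rewrite big_ord0.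
  apply/cont_seminormP.
    by split=> *; rewrite ?mulr0 ?addr0.
  move=> eps eps0; exists 0%N, (fun=> fun=> 0), 1.
  by split=> // -[].
rewrite (_ : (fun _ => _) =
    fun f => \sum_i ps (widen_ord (leqnSn k) i) f + ps ord_max f); last first.
  by apply: boolp.funext => f; rewrite big_ord_recr.
by apply: cont_seminormD => //; exact: IH.
Qed.

(** The finitely many members of [S] that control [r] are dominated by their sum, which is
    continuous for [S']. *)
Lemma cont_seminorm_trans S S' r : (forall q, S q -> cont_seminorm D S' q) ->
  cont_seminorm D S r -> cont_seminorm D S' r.
Proof.
move=> SS' cr; have [rP _] := cr; apply/cont_seminormP => // eps eps0.
have [k [ps [d [Sps d0 psd]]]] := (cont_seminormP S rP).2 cr _ eps0.
have cs := cont_seminorm_sum (fun i => SS' _ (Sps i)).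
have [sP _] := cs.
have [k' [ps' [d' [Sps' d'0 psd']]]] := (cont_seminormP S' sP).2 cs _ d0.
exists k', ps', d'; split=> // g Dg gd; apply: psd => // i.
apply: le_lt_trans (psd' g Dg gd); rewrite (bigD1 i) //= lerDl.
apply: sumr_ge0 => j _; have [jP _] := SS' _ (Sps j); exact: seminorm_ge0 jP _ Dg.
Qed.

Lemma lc_cont_id_cont_seminorm S S' q :
  lc_cont D S S' id -> S' q -> seminorm_on D q -> cont_seminorm D S q.
Proof.
move=> Sid S'q qP; split=> // f Df _ -> eps eps0.
have [k [ps [d [Sps d0 psd]]]] := Sid f Df q S'q eps eps0.
exists k, ps, d; split=> // g Dg /(psd g Dg); apply: le_lt_trans.
exact: (seminorm_dist Dsub qP).
Qed.

Lemma cont_seminorm_bounded p r : seminorm_on D p -> cont_seminorm D [set p] r ->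
  exists2 K, 0 < K & forall f, D f -> r f <= K * p f.
Proof.
move=> pP cr; have [rP _] := cr.
have [k [ps [d [Sps d0 psd]]]] := (cont_seminormP [set p] rP).2 cr 1 ltr01.
exists d^-1 => [|f Df]; first by rewrite invr_gt0.
apply/ler_addgt0Pr => eps eps0.
have pf0 := seminorm_ge0 pP Df.
have s0 : 0 < p f + eps * d by rewrite ltr_wpDl // mulr_gt0.
(* Scaling by [t] brings [f] into the ball of radius [d], whence [r f <= t^-1 = d^-1 * p f + eps].
   The term [eps * d] keeps the denominator positive when [p f = 0]. *)
pose t : R := d / (p f + eps * d).
have t0 : 0 < t by rewrite divr_gt0.
have : r (t%:C *: f) < 1.
  apply: psd => [|i]; first exact: subspaceZ.
  rewrite (Sps i) (seminormZ pP) // cabs_real (ger0_norm (ltW t0)).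
  by rewrite /t mulrAC ltr_pdivrMr // ltr_pM2l // ltrDl mulr_gt0.
rewrite (seminormZ rP) // cabs_real (ger0_norm (ltW t0)) -ltr_pdivlMl // mulr1.
move/ltW/le_trans; apply; rewrite /t invf_div mulrDl mulfK ?gt_eqF //.
by rewrite mulrC.
Qed.

(** Continuity of [r] involves only finitely many members of [S], so the maximum of their thresholds
    works. *)
Lemma cont_seminorm_cvg0 S r (u : nat -> U) : (forall n, D (u n)) ->
  (forall q, S q -> forall eps, 0 < eps ->
     exists n0, forall n, (n0 <= n)%N -> q (u n) < eps) ->
  cont_seminorm D S r ->
  forall eps, 0 < eps -> exists n0, forall n, (n0 <= n)%N -> r (u n) < eps.
Proof.
move=> Du u0 cr eps eps0; have [rP _] := cr.
have [k [ps [d [Sps d0 psd]]]] := (cont_seminormP S rP).2 cr _ eps0.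
have /boolp.choice[n0 n0P] := fun i => u0 _ (Sps i) _ d0.
exists (\max_i n0 i)%N => n n0n; apply: psd => // i; apply: n0P.
by apply: leq_trans n0n; exact: leq_bigmax.
Qed.

(** A Lipschitz bound by a continuous seminorm; it serves for the operator, its inverse and the
    coefficient functionals. *)
Lemma lc_cont_dominated (V : zmodType) S (SV : set (V -> R)) (F : U -> V) :
  (forall q : V -> R, SV q -> exists r K, [/\ cont_seminorm D S r, 0 < K &
     forall f g, D f -> D g -> q (F g - F f) <= K * r (g - f)]) ->
  lc_cont D S SV F.
Proof.
move=> dom f Df q /dom[r [K [cr K0 qr]]] eps eps0; have [rP _] := cr.
have epsK : 0 < eps / K by rewrite divr_gt0.
have [k [ps [d [Sps d0 psd]]]] := (cont_seminormP S rP).2 cr _ epsK.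
exists k, ps, d; split=> // g Dg gd.
apply: (le_lt_trans (qr f g Df Dg)); rewrite -ltr_pdivlMl // mulrC.
by apply: psd => //; exact: subspaceB.
Qed.

End ContinuousSeminorms.

(** * Sequences and completeness *)

Lemma harmonic_lt (R : realType) (eps : R) : 0 < eps ->
  exists n0, forall n, (n0 <= n)%N -> n.+1%:R^-1 < eps.
Proof.
move=> eps0; exists (Num.bound eps^-1) => n n0n.
rewrite -[eps]invrK ltf_pV2 ?posrE ?ltr0n ?invr_gt0 //.
have := archi_boundP (ltW (_ : 0 < eps^-1)).
rewrite invr_gt0 => /(_ eps0)/lt_le_trans.
by apply; rewrite ler_nat leqW.
Qed.

(** Filter completeness is applied to the image of the filter at infinity under [x], whose small
    sets are the tails of the sequence. *)
Lemma seq_complete (R : realType) (U : lmodType R[i]) (D : set U)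
    (S : set (U -> R)) :
  lc_complete D S -> forall x : nat -> U, (forall n, D (x n)) ->
  (forall q, S q -> forall eps, 0 < eps -> exists n0, forall m n,
     (n0 <= m)%N -> (n0 <= n)%N -> q (x m - x n) < eps) ->
  exists2 f, D f & forall q, S q -> forall eps, 0 < eps ->
    exists n0, forall n, (n0 <= n)%N -> q (x n - f) < eps.
Proof.
move=> cD x Dx xC; have [||f Df xf] := cD (x @ \oo).
- by exists 0%N => // n _; exact: Dx.
- move=> q Sq eps /(xC q Sq)[n0 n0P]; exists [set x n | n in [set n | (n0 <= n)%N]].
    by exists n0 => // n /= n0n; exists n.
  by move=> _ _ [m mn0 <-] [n nn0 <-]; exact: n0P.
exists f => // q Sq eps /(xf q Sq)[n0 _ n0P]; exists n0 => n n0n.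
exact: (n0P n n0n).
Qed.

(** * The closed correspondence between the two spaces *)

Section Correspondence.
Variables (R : realType) (H : lmodType R[i]) (ip : H -> H -> R[i]) (D : set H)
  (S : set (H -> R)) (xi e : nat -> H) (p : H -> R).
Local Notation N := (ipnorm ip).
Hypotheses (ipP : inner_product_on [set: H] ip)
  (H_complete : ip_complete [set: H] ip)
  (Dsub : subspace D) (S_seminorm : forall q, S q -> seminorm_on D q)
  (D_complete : lc_complete D S) (Dxi : forall n, D (xi n))
  (xi_dense : forall r, cont_seminorm D S r -> forall f, D f ->
     forall eps, 0 < eps -> exists n c, r (f - lincomb xi n c) < eps)
  (e_dense : forall h eps, 0 < eps -> exists n c, N (h - lincomb e n c) < eps)
  (p_cont : cont_seminorm D S p)
  (p_lower : forall n c, N (lincomb e n c) <= p (lincomb xi n c))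
  (q_upper : forall q, cont_seminorm D S q -> exists2 K, 0 < K &
     forall n c, q (lincomb xi n c) <= K * N (lincomb e n c)).

Let NP : seminorm_on [set: H] N := ipnorm_seminorm (subspaceT H) ipP.
Let Dlin n c : D (lincomb xi n c) := subspace_lincomb n c Dsub Dxi.

(* The closure of the graph of the map sum c_i xi_i |-> sum c_i e_i. *)
Definition corr (f h : H) : Prop :=
  forall r, cont_seminorm D S r -> forall eps, 0 < eps ->
    exists n c, r (f - lincomb xi n c) < eps /\ N (h - lincomb e n c) < eps.

Lemma corr_gen n : corr (xi n) (e n).
Proof.
move=> r cr eps eps0; exists n.+1, (fun i => (i == n)%:R).
rewrite !lincomb_delta !subrr (seminorm0 (subspaceT H) NP).
by have [rP _] := cr; rewrite (seminorm0 Dsub rP).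
Qed.

Lemma corr_lin a f f' h h' : D f -> D f' -> corr f h -> corr f' h' ->
  corr (a *: f + f') (a *: h + h').
Proof.
move=> Df Df' fh fh' r cr eps eps0; have [rP _] := cr.
(* The shift by 1 allows division by [b] even when [a = 0]. *)
pose b := cabs a + 1; have b0 : 0 < b by rewrite ltr_wpDl ?cabs_ge0.
have ab : cabs a <= b by rewrite lerDl.
have eps2 : 0 < eps / 2 by rewrite divr_gt0.
have [n [c [fc hc]]] := fh r cr (eps / 2 / b) (divr_gt0 eps2 b0).
have [n' [c' [fc' hc']]] := fh' r cr _ eps2.
rewrite (lincomb_widen _ _ (leq_maxl n n')) in fc.
rewrite (lincomb_widen _ _ (leq_maxl n n')) in hc.
rewrite (lincomb_widen _ _ (leq_maxr n n')) in fc'.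
rewrite (lincomb_widen _ _ (leq_maxr n n')) in hc'.
move: fc hc fc' hc'; set m := maxn n n'; set d := fun i => _; set d' := fun i => _.
move=> fc hc fc' hc'; exists m, (fun i => a * d i + d' i).
(* One estimate serves for both components: [r] on [D] and the norm on [H]. *)
have aux (q : H -> R) (D' : set H) y x x' : subspace D' -> seminorm_on D' q ->
    D' x -> D' x' -> (forall n c, D' (lincomb y n c)) ->
    q (x - lincomb y m d) < eps / 2 / b -> q (x' - lincomb y m d') < eps / 2 ->
    q (a *: x + x' - lincomb y m (fun i => a * d i + d' i)) < eps.
  move=> D'sub qP D'x D'x' D'y xd x'd'.
  have Dxd := subspaceB D'sub D'x (D'y m d).
  have Dxd' := subspaceB D'sub D'x' (D'y m d').
  rewrite lincombD opprD addrACA -scalerBr.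
  apply: le_lt_trans (seminormD qP (subspaceZ D'sub a Dxd) Dxd') _.
  rewrite [eps]splitr; apply: ler_ltD => //.
  rewrite (seminormZ qP) //; apply: le_trans (ler_pM _ _ ab (ltW xd)) _.
  - exact: cabs_ge0.
  - exact: seminorm_ge0 qP _ _.
  - by rewrite mulrC divfK // gt_eqF.
by split; [apply: (aux r D xi) | apply: (aux N setT e)].
Qed.

Lemma corrB f f' h h' : D f -> D f' -> corr f h -> corr f' h' ->
  corr (f - f') (h - h').
Proof.
move=> Df Df' fh fh'; rewrite addrC [h - _]addrC -(scaleN1r f') -(scaleN1r h').
exact: corr_lin.
Qed.

Lemma corr_lower f h : D f -> corr f h -> N h <= p f.
Proof.
move=> Df fh; have [pP _] := p_cont; apply/ler_addgt0Pr => eps eps0.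
have eps2 : 0 < eps / 2 by rewrite divr_gt0.
have [n [c [fc hc]]] := fh p p_cont _ eps2.
have := seminorm_tri (subspaceT H) NP (I : setT h) (I : setT (lincomb e n c)).
have := seminorm_tri Dsub pP (Dlin n c) Df.
rewrite (seminormBC Dsub pP) //.
have := p_lower n c; lra.
Qed.

Lemma corr_upper q : cont_seminorm D S q ->
  exists2 K, 0 < K & forall f h, D f -> corr f h -> q f <= K * N h.
Proof.
move=> cq; have [qP _] := cq; have [K K0 qK] := q_upper cq; exists K => // f h Df fh.
apply/ler_addgt0Pr => eps eps0.
have K1 : 0 < 1 + K by rewrite addr_gt0.
(* The precision [d = eps / (1 + K)] makes the two errors, [d] in [D] and [K * d] coming from [H],
   add up to [eps]. *)
have [n [c [fc hc]]] := fh q cq _ (divr_gt0 eps0 K1).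
move: fc hc; set d := eps / _ => fc hc.
have epsE : eps = d + K * d.
  by rewrite /d -{1}[_ / _]mul1r -mulrDl mulrC divfK // gt_eqF.
have h1 := seminorm_tri (subspaceT H) NP (I : setT (lincomb e n c)) (I : setT h).
rewrite (seminormBC (subspaceT H) NP) // in h1.
have h2 := seminorm_tri Dsub qP Df (Dlin n c).
have h3 := qK n c.
have h4 : K * N (lincomb e n c) <= K * (N h + d).
  by rewrite ler_pM2l //; lra.
rewrite epsE; lra.
Qed.

(** Approximations of [f] in [p] have images that are Cauchy in [H], by the lower bound; their limit
    is the partner of [f]. *)
Lemma corr_total f : D f -> exists h, corr f h.
Proof.
move=> Df; have [pP _] := p_cont.
have /boolp.choice[nc ncP] : forall k, exists nc : nat * (nat -> R[i]),
    p (f - lincomb xi nc.1 nc.2) < k.+1%:R^-1.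
  move=> k; have k0 : 0 < k.+1%:R^-1 :> R by rewrite invr_gt0 ltr0n.
  by have [n [c fc]] := xi_dense p_cont Df k0; exists (n, c).
pose x k := lincomb xi (nc k).1 (nc k).2; pose y k := lincomb e (nc k).1 (nc k).2.
have lower2 n c m d : N (lincomb e n c - lincomb e m d) <=
    p (lincomb xi n c - lincomb xi m d).
  rewrite !(lincomb_widen _ _ (leq_maxl n m)) !(lincomb_widen _ _ (leq_maxr n m)).
  by rewrite -!lincombB.
have [||h _ yh] := @H_complete y => //.
  move=> eps eps0; have eps2 : 0 < eps / 2 by rewrite divr_gt0.
  have [n0 n0P] := harmonic_lt eps2; exists n0 => m n mn0 nn0.
  apply: le_lt_trans (lower2 _ _ _ _) _; rewrite -/(x m) -/(x n).
  have := seminormD pP (subspaceB Dsub (Dlin _ _ : D (x m)) Df)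
                        (subspaceB Dsub Df (Dlin _ _ : D (x n))).
  rewrite subrKA (seminormBC Dsub pP (Dlin _ _) Df).
  have := lt_trans (ncP m) (n0P _ mn0); have := lt_trans (ncP n) (n0P _ nn0).
  rewrite -/(x m) -/(x n); lra.
exists h => r cr eps eps0; have [rP _] := cr.
(* The sequence [x] is controlled only in [p]. A fresh approximation, close for [r + p], is close to
   [f] in [r], and its image is close to the [y k] through [p]. *)
have crp := cont_seminormD Dsub cr p_cont; have [rpP _] := crp.
have eps4 : 0 < eps / 4 by rewrite divr_gt0.
have [n [c fc]] := xi_dense crp Df eps4; exists n, c.
have Dfc := subspaceB Dsub Df (Dlin n c).
have r0 := seminorm_ge0 rP Dfc; have p0 := seminorm_ge0 pP Dfc.
rewrite /= in fc.
split; first by lra.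
have [n1 n1P] := harmonic_lt eps4; have [n2 n2P] := yh _ eps4.
pose k := maxn n1 n2.
have := lt_trans (ncP k) (n1P k (leq_maxl _ _)); have := n2P k (leq_maxr _ _).
rewrite -/(x k) => yk xk.
have := seminormD pP (subspaceB Dsub (Dlin _ _ : D (x k)) Df) Dfc.
rewrite subrKA (seminormBC Dsub pP (Dlin _ _) Df).
have := lower2 (nc k).1 (nc k).2 n c; rewrite -/(x k) -/(y k).
have := seminormD NP (I : setT (h - y k)) (I : setT (y k - lincomb e n c)).
rewrite subrKA (seminormBC (subspaceT H) NP (I : setT h) (I : setT (y k))).
lra.
Qed.

(** The roles are exchanged: approximations of [h] in [H] have preimages that are Cauchy for every
    member of [S], by the upper bound. Their limit in [D] is approached in all continuous seminorms,
    so the same sequence serves for every [r]. *)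
Lemma corr_onto h : exists2 f, D f & corr f h.
Proof.
have /boolp.choice[nc ncP] : forall k, exists nc : nat * (nat -> R[i]),
    N (h - lincomb e nc.1 nc.2) < k.+1%:R^-1.
  move=> k; have k0 : 0 < k.+1%:R^-1 :> R by rewrite invr_gt0 ltr0n.
  by have [n [c hc]] := e_dense h k0; exists (n, c).
pose x k := lincomb xi (nc k).1 (nc k).2; pose y k := lincomb e (nc k).1 (nc k).2.
have [||f Df xf] := @seq_complete _ _ _ _ D_complete x.
- by move=> n; exact: Dlin.
- move=> q Sq eps eps0; have cq := cont_seminorm_in Dsub (S_seminorm Sq) Sq.
  have [K K0 qK] := q_upper cq.
  have upper2 n c m d : q (lincomb xi n c - lincomb xi m d) <=
      K * N (lincomb e n c - lincomb e m d).
    rewrite !(lincomb_widen _ _ (leq_maxl n m)) !(lincomb_widen _ _ (leq_maxr n m)).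
    by rewrite -!lincombB.
  have epsK : 0 < eps / K / 2 by rewrite !divr_gt0.
  have [n0 n0P] := harmonic_lt epsK; exists n0 => m n mn0 nn0.
  apply: le_lt_trans (upper2 _ _ _ _) _; rewrite -/(y m) -/(y n).
  rewrite -ltr_pdivlMl // mulrC.
  have := seminormD NP (I : setT (y m - h)) (I : setT (h - y n)).
  rewrite subrKA (seminormBC (subspaceT H) NP (I : setT (y m)) (I : setT h)).
  have := lt_trans (ncP m) (n0P _ mn0); have := lt_trans (ncP n) (n0P _ nn0).
  rewrite -/(y m) -/(y n); lra.
exists f => // r cr eps eps0; have [rP _] := cr.
have Dxf n : D (x n - f) := subspaceB Dsub (Dlin _ _) Df.
have [n1 n1P] := cont_seminorm_cvg0 Dsub Dxf xf cr eps0.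
have [n2 n2P] := harmonic_lt eps0; pose k := maxn n1 n2.
exists (nc k).1, (nc k).2; split.
  by rewrite (seminormBC Dsub rP) //; exact: n1P k (leq_maxl _ _).
exact: lt_trans (ncP k) (n2P k (leq_maxr _ _)).
Qed.

End Correspondence.

(** * The three implications of the cycle *)

Section Equivalence.
Variables (R : realType) (H : lmodType R[i]) (ip : H -> H -> R[i]) (D : set H)
  (S : set (H -> R)) (xi : nat -> H).
Local Notation N := (ipnorm ip).
Hypotheses (rigged : rigged_hilbert_space ip D S) (D_complete : lc_complete D S)
  (Dxi : forall n, D (xi n)).

Definition invertible_riesz_like : Prop :=
  riesz_like_basis ip D S xi /\
  exists T, riesz_operator ip D S xi T /\
    exists Tinv : H -> H,
      [/\ forall h, D (Tinv h),
          forall h, T (Tinv h) = h,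
          forall f, D f -> Tinv (T f) = f &
          lc_cont setT [set ipnorm ip] S Tinv].

Definition orthonormal_for_equivalent_norm : Prop :=
  exists ip1 : H -> H -> R[i],
    [/\ hilbert_on D ip1,
        lc_cont D S [set ipnorm ip1] id,
        lc_cont D [set ipnorm ip1] S id &
        onb_on D ip1 xi].

Definition complete_with_l2_bounds : Prop :=
  [/\ (forall f, D f -> forall (k : nat) (ps : 'I_k -> H -> R) (d : R),
         (forall j, S (ps j)) -> 0 < d ->
         exists (n : nat) (c : nat -> R[i]),
           forall j, ps j (f - \sum_(i < n) c i *: xi i) < d),
      (exists p, cont_seminorm D S p /\
         forall (n : nat) (c : nat -> R[i]),
           \sum_(i < n) cabs (c i) ^+ 2 <= p (\sum_(i < n) c i *: xi i) ^+ 2) &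
      (forall q, cont_seminorm D S q -> exists2 Cq : R, 0 < Cq &
         forall (n : nat) (c : nat -> R[i]),
           q (\sum_(i < n) c i *: xi i) ^+ 2 <= Cq * \sum_(i < n) cabs (c i) ^+ 2)].

Let ipP : inner_product_on [set: H] ip.
Proof. by case: rigged => -[]. Qed.
Let H_complete : ip_complete [set: H] ip.
Proof. by case: rigged => -[]. Qed.
Let Dsub : subspace D.
Proof. by case: rigged. Qed.
Let D_dense h eps : 0 < eps -> exists2 f, D f & N (h - f) < eps.
Proof. by case: rigged => _ _ + _ _; exact. Qed.
Let S_seminorm q : S q -> seminorm_on D q.
Proof. by case: rigged => _ _ _ + _; exact. Qed.
Let NP : seminorm_on [set: H] N := ipnorm_seminorm (subspaceT H) ipP.
Let N_cont : cont_seminorm D S N.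
Proof.
case: rigged => _ _ _ _ idc; apply: (lc_cont_id_cont_seminorm Dsub idc) => //.
by case: NP => N1 N2 N3; split=> *; [exact: N1|exact: N2|exact: N3].
Qed.

(** [T] becomes an isometry for the transported product, so continuity of [T] and of [Tinv] are the
    two comparisons of topologies, and density of the span of the [T (xi n)] pulls back. *)
Lemma equivalent_norm_of_riesz :
  invertible_riesz_like -> orthonormal_for_equivalent_norm.
Proof.
move=> [_ [T [[Tlin Tcont Tinj [_ TON Tdense]] [Tinv [DTi TTi TiT Ticont]]]]].
have T0 : T 0 = 0.
  have := Tlin (-1) 0 0 (subspace0 Dsub) (subspace0 Dsub).
  by rewrite scaler0 addr0 scaleN1r addNr.
have TB f g : D f -> D g -> T (f - g) = T f - T g.
  by move=> Df Dg; rewrite addrC -scaleN1r Tlin // scaleN1r addrC.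
have Tsum n c : T (lincomb xi n c) = lincomb (fun i => T (xi i)) n c.
  elim: n => [|n IH]; first by rewrite /lincomb !big_ord0.
  rewrite !lincombS addrC Tlin ?IH 1?addrC //.
  exact: subspace_lincomb.
have N1E f : ipnorm (fun f g => ip (T f) (T g)) f = N (T f) by [].
exists (fun f g => ip (T f) (T g)); split.
- split=> //.
    split=> [a f g h Df Dg Dh|f g Df Dg|f Df|f Df ff].
    + by rewrite Tlin // (ip_linl ipP).
    + exact: (ip_conj ipP).
    + by case: ipP => _ _ + _; exact.
    (* Definiteness of the new product is the injectivity of [T]. *)
    + apply: Tinj; rewrite ?inE //; first exact: subspace0.
      by rewrite T0; case: ipP => _ _ _; exact.
  move=> u Du uC; have [||h _ uh] := @H_complete (T \o u) => //.
    move=> eps /uC[n0 n0P]; exists n0 => m n mn0 nn0.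
    by rewrite /= -TB //; exact: n0P.
  (* Surjectivity of [T] brings the limit found in [H] back into [D]. *)
  exists (Tinv h) => // eps /uh[n0 n0P]; exists n0 => n nn0.
  by rewrite N1E TB // TTi; exact: n0P.
- move=> f Df _ -> eps eps0.
  have [k [ps [d [Sps d0 psd]]]] := Tcont f Df N erefl eps eps0.
  exists k, ps, d; split=> // g Dg /(psd g Dg).
  by rewrite N1E TB.
- move=> f Df q Sq eps eps0.
  have [k [ps [d [Sps d0 psd]]]] := Ticont (T f) I q Sq eps eps0.
  exists k, (fun=> ipnorm (fun f g => ip (T f) (T g))), d; split=> // g Dg gd.
  have := psd (T g) I; rewrite !TiT //; apply=> i.
  by rewrite (Sps i) -TB //; exact: gd.
- split=> // f Df eps eps0; have [n [c fc]] := Tdense (T f) I eps eps0.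
  exists n, c; rewrite N1E TB ?Tsum //.
  exact: (subspace_lincomb n c Dsub Dxi).
Qed.

(** With the new norm as [p], the lower bound is the Parseval equality; the upper bound is the
    domination of every continuous seminorm by this norm. *)
Lemma l2_bounds_of_equivalent_norm :
  orthonormal_for_equivalent_norm -> complete_with_l2_bounds.
Proof.
move=> [ip1 [[_ ip1P _] idc1 idc2 [_ xiON xi_dense]]].
have N1P := ipnorm_seminorm Dsub ip1P.
have N1_cont : cont_seminorm D S (ipnorm ip1).
  exact: (lc_cont_id_cont_seminorm Dsub idc1).
have S_N1 q : S q -> cont_seminorm D [set ipnorm ip1] q.
  by move=> Sq; apply: (lc_cont_id_cont_seminorm Dsub idc2 Sq); exact: S_seminorm.
split.
- move=> f Df k ps d Sps d0.
  (* Bounding the sum of the [ps j] lets a single combination approximate [f] for all of them at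
     once. *)
  have cs := cont_seminorm_sum Dsub (fun j => S_N1 _ (Sps j)).
  have [K K0 sK] := cont_seminorm_bounded Dsub N1P cs.
  have [n [c fc]] := xi_dense f Df (d / K) (divr_gt0 d0 K0).
  exists n, c => j.
  have Dfc := subspaceB Dsub Df (subspace_lincomb n c Dsub Dxi).
  apply: (@le_lt_trans _ _ (\sum_i ps i (f - lincomb xi n c))).
    rewrite (bigD1 j) //= lerDl; apply: sumr_ge0 => i _.
    exact (seminorm_ge0 (S_seminorm (Sps i)) Dfc).
  apply: (le_lt_trans (sK _ Dfc)).
  by rewrite -ltr_pdivlMl // mulrC.
- exists (ipnorm ip1); split=> // n c.
  by rewrite -(ipnorm_lincomb_orthonormal Dsub ip1P Dxi xiON).
- move=> q cq; have [qP _] := cq.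
  have cq1 := cont_seminorm_trans Dsub S_N1 cq.
  have [K K0 qK] := cont_seminorm_bounded Dsub N1P cq1.
  exists (K ^+ 2) => [|n c]; first exact: exprn_gt0.
  have DL := subspace_lincomb n c Dsub Dxi.
  rewrite -(ipnorm_lincomb_orthonormal Dsub ip1P Dxi xiON) -exprMn.
  rewrite ler_pXn2r ?nnegrE //; [exact: qK|exact (seminorm_ge0 qP DL)|].
  by rewrite mulr_ge0 ?ipnorm_ge0 // ltW.
Qed.

Lemma riesz_of_l2_bounds :
  complete_with_l2_bounds -> invertible_riesz_like.
Proof.
move=> [dense [p [p_cont p_low]] q_up].
have [pP _] := p_cont.
have xi_dense r : cont_seminorm D S r -> forall f, D f ->
    forall eps, 0 < eps -> exists n c, r (f - lincomb xi n c) < eps.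
  move=> cr f Df eps eps0; have [rP _] := cr.
  have [k [ps [d [Sps d0 psd]]]] := (cont_seminormP Dsub S rP).2 cr eps eps0.
  have [n [c fc]] := dense f Df k ps d Sps d0; exists n, c.
  by apply: psd => //; apply: subspaceB => //; exact: subspace_lincomb.
(* A vanishing combination has [p] equal to 0, so the lower bound forces all its coefficients to
   vanish. *)
have xi_free n c : lincomb xi n c = 0 -> forall i, (i < n)%N -> c i = 0.
  move=> c0 i ltin; apply: (@Normc.eq0_normc R); rewrite -/(cabs _); apply/eqP.
  have := p_low n c; rewrite -/(lincomb xi n c) c0 (seminorm0 Dsub pP) expr0n /=.
  rewrite (bigD1 (Ordinal ltin)) //= => cn.
  rewrite -sqrf_eq0 eq_le sqr_ge0 andbT (le_trans _ cn) // lerDl.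
  by apply: sumr_ge0 => j _; exact: sqr_ge0.
pose e := gram_schmidt ip xi.
have eON := gram_schmidt_orthonormal (subspaceT H) ipP (fun=> I) xi_free.
rewrite -/e in eON.
have NL n c : N (lincomb e n c) ^+ 2 = \sum_(i < n) cabs (c i) ^+ 2.
  exact: (ipnorm_lincomb_orthonormal (subspaceT H) ipP (fun=> I) eON).
(* First [h] is approximated by some [f] in [D], then [f] by the span of [xi]; the norm of [H] is a
   continuous seminorm on [D], so both errors are measured in it. *)
have e_dense h eps : 0 < eps -> exists n c, N (h - lincomb e n c) < eps.
  move=> eps0; have eps2 : 0 < eps / 2 by rewrite divr_gt0.
  have [f Df hf] := D_dense h eps2.
  have [n [c fc]] := xi_dense N N_cont f Df _ eps2.
  have xc : in_span xi n (lincomb xi n c) by exists c.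
  have [c' cc'] := gram_schmidt_span (subspaceT H) ipP (fun=> I) xc.
  exists n, c'; rewrite -cc' -(subrKA f) [eps]splitr.
  exact: le_lt_trans (seminormD NP I I) (ltrD hf fc).
have Dlin n c := subspace_lincomb n c Dsub Dxi.
have p_lower n c : N (lincomb e n c) <= p (lincomb xi n c).
  rewrite -(@ler_pXn2r _ 2) ?nnegrE ?ipnorm_ge0 ?(seminorm_ge0 pP) // NL.
  exact: p_low.
have q_upper q : cont_seminorm D S q -> exists2 K, 0 < K &
    forall n c, q (lincomb xi n c) <= K * N (lincomb e n c).
  move=> cq; have [C C0 qC] := q_up q cq; have [qP _] := cq.
  exists (Num.sqrt C) => [|n c]; first by rewrite sqrtr_gt0.
  rewrite -(@ler_pXn2r _ 2) ?nnegrE ?mulr_ge0 ?sqrtr_ge0 ?ipnorm_ge0 //.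
    by rewrite exprMn (sqr_sqrtr (ltW C0)) NL; exact: qC.
  exact (seminorm_ge0 qP (Dlin n c)).
pose G := corr ip D S xi e.
have G_lin a f f' h h' : D f -> D f' -> G f h -> G f' h' ->
    G (a *: f + f') (a *: h + h') by exact: corr_lin.
have G_B f f' h h' : D f -> D f' -> G f h -> G f' h' -> G (f - f') (h - h').
  by exact: corrB.
have G_lower f h : D f -> G f h -> N h <= p f by exact: corr_lower.
have G_upper q : cont_seminorm D S q ->
    exists2 K, 0 < K & forall f h, D f -> G f h -> q f <= K * N h.
  exact: corr_upper.
(* The pair [(f - f, h - h')] lies in the graph, and the lower bound gives
   [N (h - h') <= p 0 = 0]. *)
have G_fun f h h' : D f -> G f h -> G f h' -> h = h'.
  move=> Df fh fh'; apply/subr0_eq/(ipnorm_eq0 ipP I)/le_anti.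
  have := G_lower _ _ (subspaceB Dsub Df Df) (G_B _ _ _ _ Df Df fh fh').
  by rewrite subrr (seminorm0 Dsub pP) => ->; exact: ipnorm_ge0.
(* The upper bound is used with the norm of [H] as seminorm, since a norm separates points. *)
have G_inj f f' h : D f -> D f' -> G f h -> G f' h -> f = f'.
  move=> Df Df' fh fh'; apply/subr0_eq/(ipnorm_eq0 ipP I)/le_anti.
  have [K K0 NK] := G_upper N N_cont.
  have := NK _ _ (subspaceB Dsub Df Df') (G_B _ _ _ _ Df Df' fh fh').
  rewrite subrr (seminorm0 (subspaceT H) NP) mulr0 => ->; exact: ipnorm_ge0.
(* [T] has to be total on [H]; its values outside [D] are left unconstrained. *)
have /boolp.choice[T TP] : forall f, exists h, D f -> G f h.
  move=> f; have [Df|nDf] := boolp.pselect (D f); last by exists 0.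
  have [h fh] := corr_total ipP H_complete Dsub Dxi xi_dense p_cont p_lower Df.
  by exists h.
have /boolp.choice[Tinv TinvP] : forall h, exists f, D f /\ G f h.
  move=> h.
  have [f Df fh] := corr_onto ipP Dsub S_seminorm D_complete Dxi e_dense q_upper h.
  by exists f.
have DTi h : D (Tinv h) by case: (TinvP h).
have GTi h : G (Tinv h) h by case: (TinvP h).
have Txi n : T (xi n) = e n.
  apply: (G_fun (xi n)) => //; first exact: TP.
  exact: corr_gen.
have TTi h : T (Tinv h) = h by apply: (G_fun (Tinv h)) => //; exact: TP.
have TiT f : D f -> Tinv (T f) = f.
  by move=> Df; apply: (G_inj _ _ (T f)) => //; exact: TP.
have NTB f g : D f -> D g -> N (T g - T f) <= p (g - f).
  move=> Df Dg; apply: G_lower; first exact: subspaceB.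
  by apply: G_B => //; exact: TP.
have Triesz : riesz_operator ip D S xi T.
  split.
  - move=> a f g Df Dg; have Dafg := (proj2 Dsub) a f g Df Dg.
    by apply: (G_fun (a *: f + g)) => //; [|apply: G_lin => //]; exact: TP.
  - apply: lc_cont_dominated => // _ ->; exists p, 1; split=> // f g Df Dg.
    by rewrite mul1r; exact: NTB.
  - move=> f g; rewrite !inE => Df Dg Tfg; apply: (G_inj _ _ (T f)) => //.
      exact: TP.
    by rewrite Tfg; exact: TP.
  - have -> : (fun n => T (xi n)) = e by exact: boolp.funext.
    by split=> // h _ eps; exact: e_dense.
split; last first.
  exists T; split=> //; exists Tinv; split=> //.
  apply: lc_cont_dominated => // q Sq.
  have [K K0 qK] := G_upper q (cont_seminorm_in Dsub (S_seminorm Sq) Sq).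
  exists N, K; split=> // [|f g _ _].
    exact: cont_seminorm_in.
  by apply: qK; [exact: subspaceB|exact: G_B].
split; last by exists T.
(* The coefficients of [f] are the Fourier coefficients of [T f], bounded by [p] through
   Cauchy-Schwarz and the lower bound. *)
split=> //; exists (fun n f => ip (T f) (e n)); split=> [n|f Df].
  apply: lc_cont_dominated => // _ ->; exists p, 1; split=> // f g Df Dg.
  rewrite mul1r -(ipBl ipP) //; apply: le_trans (NTB _ _ Df Dg).
  have := ip_CauchySchwarz (subspaceT H) ipP (I : setT (T g - T f)) (I : setT (e n)).
  by rewrite (ipnorm_orthonormal eON) mulr1.
have GL n c : G (lincomb xi n c) (lincomb e n c).
  move=> r cr eps eps0; exists n, c; have [rP _] := cr.
  by rewrite !subrr (seminorm0 (subspaceT H) NP) (seminorm0 Dsub rP).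
(* Existence: the upper bound carries convergence of the Fourier series of [T f] back to each [q] in
   [S]. Uniqueness: the lower bound carries an expansion of [f] to one of [T f], whose coefficients
   are determined. *)
split=> [q Sq eps eps0|c fc].
  have [K K0 qK] := G_upper q (cont_seminorm_in Dsub (S_seminorm Sq) Sq).
  have [n0 n0P] := fourier_cvg (subspaceT H) ipP (fun=> I) eON
    (e_dense (T f)) I (divr_gt0 eps0 K0).
  exists n0 => n /n0P; rewrite ltr_pdivlMr // mulrC; apply: le_lt_trans.
  exact: (qK _ _ (subspaceB Dsub Df (Dlin n _))
                 (G_B _ _ _ _ Df (Dlin n _) (TP f Df) (GL n _))).
apply: boolp.funext => n; apply/esym.
apply: (fourier_coef_unique (subspaceT H) ipP (fun=> I) eON I) => eps eps0.
have Dfc n1 : D (f - lincomb xi n1 c) := subspaceB Dsub Df (Dlin n1 c).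
have [n0 n0P] := cont_seminorm_cvg0 Dsub Dfc fc p_cont eps0.
exists n0 => n1 /n0P; apply: le_lt_trans; apply: (G_lower _ _ (Dfc n1)).
exact: (G_B _ _ _ _ Df (Dlin n1 c) (TP f Df) (GL n1 c)).
Qed.

End Equivalence.

Theorem theorem3p9 (R : realType) (H : lmodType R[i]) (ip : H -> H -> R[i])
  (D : set H) (S : set (H -> R)) (xi : nat -> H) :
  rigged_hilbert_space ip D S ->
  lc_complete D S -> lc_reflexive D S ->
  (forall n, D (xi n)) ->
  let stmt_i :=
    riesz_like_basis ip D S xi /\
    exists T, riesz_operator ip D S xi T /\
      exists Tinv : H -> H,
        [/\ forall h, D (Tinv h),
            forall h, T (Tinv h) = h,
            forall f, D f -> Tinv (T f) = f &
            lc_cont setT [set ipnorm ip] S Tinv] in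
  let stmt_ii :=
    exists ip1 : H -> H -> R[i],
      [/\ hilbert_on D ip1,
          lc_cont D S [set ipnorm ip1] id,
          lc_cont D [set ipnorm ip1] S id &
          onb_on D ip1 xi] in
  let stmt_iii :=
    [/\ (forall f, D f -> forall (k : nat) (ps : 'I_k -> H -> R) (d : R),
           (forall j, S (ps j)) -> 0 < d ->
           exists (n : nat) (c : nat -> R[i]),
             forall j, ps j (f - \sum_(i < n) c i *: xi i) < d),
        (exists p, cont_seminorm D S p /\
           forall (n : nat) (c : nat -> R[i]),
             \sum_(i < n) cabs (c i) ^+ 2 <= p (\sum_(i < n) c i *: xi i) ^+ 2) &
        (forall q, cont_seminorm D S q -> exists2 Cq : R, 0 < Cq &
           forall (n : nat) (c : nat -> R[i]),
             q (\sum_(i < n) c i *: xi i) ^+ 2 <= Cq * \sum_(i < n) cabs (c i) ^+ 2)] in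
  (stmt_i <-> stmt_ii) /\ (stmt_ii <-> stmt_iii).
Proof.
move=> rigged D_complete _ Dxi /=.
have i_ii := equivalent_norm_of_riesz rigged Dxi.
have ii_iii := l2_bounds_of_equivalent_norm rigged Dxi.
have iii_i := riesz_of_l2_bounds rigged D_complete Dxi.
split; first by split=> [/i_ii|/ii_iii/iii_i].
by split=> [/ii_iii|/iii_i/i_ii].
Qed.
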